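(* Suppose that $\mathfrak g$ is a filiform nilpotent metric Lie algebra, $\mathfrak h$ is a proper subalgebra of $\mathfrak g$, and $\mathfrak h^{\perp}$ is $\mathfrak h$-invariant. Then $\dim(\mathfrak h)\leq \dim(\mathfrak g)/2$.
   Context: All Lie algebras are finite-dimensional and over $\mathbb R$. A metric Lie algebra is a Lie algebra equipped with an inner product $\langle\cdot,\cdot\rangle$ (an arbitrary inner product on the underlying vector space; no compatibility with the bracket is assumed). For a subalgebra $\mathfrak h$ of a metric Lie algebra $\mathfrak g$, $\mathfrak h^\perp$ denotes its orthogonal complement in $\mathfrak g$. One says that $\mathfrak h^\perp$ is $\mathfrak h$-invariant if $[X,Y]\in\mathfrak h^\perp$ for all $X\in\mathfrak h^\perp$, $Y\in\mathfrak h$. A nilpotent Lie algebra $\mathfrak g$ of dimension $n$ is filiform if there exists $X\in\mathfrak g$ with $\operatorname{ad}^{n-2}(X)\neq 0$, where $\operatorname{ad}(X)(Y)=[X,Y]$ and $\operatorname{ad}^{k}(X)$ is the $k$-fold composition of $\operatorname{ad}(X)$. *)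

(* Defs.v *)
From HB Require Import structures.
From mathcomp Require Import all_boot all_order all_algebra.
From mathcomp Require Import reals.

Set Implicit Arguments.
Unset Strict Implicit.
Unset Printing Implicit Defensive.

Import GRing.Theory.
Local Open Scope ring_scope.

Declare Scope lie_scope.
Delimit Scope lie_scope with lie.

HB.mixin Record Vector_isLieAlgebra (F : fieldType) V of Vector F V := {
  lie_bracket : V -> V -> V;
  lie_bracket_bilinear : bilinear_for *:%R *:%R lie_bracket;
  lie_bracketxx : forall x, lie_bracket x x = 0;
  lie_jacobi : forall x y z,
    lie_bracket x (lie_bracket y z) + lie_bracket y (lie_bracket z x)
      + lie_bracket z (lie_bracket x y) = 0
}.

#[short(type="lieAlgType")]
HB.structure Definition LieAlgebra (F : fieldType) :=
  {V of Vector_isLieAlgebra F V & Vector F V}.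

Notation "[ x , y ]" := (lie_bracket x y)
  (at level 0, x, y at level 200, format "[ x ,  y ]") : lie_scope.
Local Open Scope lie_scope.

HB.instance Definition _ (F : fieldType) (g : lieAlgType F) :=
  bilinear_isBilinear.Build F g g g _ _ (@lie_bracket F g) lie_bracket_bilinear.

#[non_forgetful_inheritance]
HB.instance Definition _ (F : fieldType) (g : lieAlgType F) (x : g) :=
  GRing.isLinear.Build F g g *:%R (lie_bracket x) (lie_bracket_bilinear.2 x).

Section LieAlgebra.
Variables (F : fieldType) (g : lieAlgType F).
Implicit Types (x y : g) (U V W h : {vspace g}).

(* [U, V] is the span of all brackets; by bilinearity the brackets of basis
   vectors suffice, see lie_prodvP. *)
Definition lie_prodv U V : {vspace g} :=
  <<[seq [x, y] | x <- vbasis U, y <- vbasis V]>>%VS.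

Lemma lie_prodvP U V W :
  reflect {in U & V, forall x y, [x, y] \in W} (lie_prodv U V <= W)%VS.
Proof.
apply: (iffP span_subvP) => [sub_W x y xU yV | sub_W z /allpairsP[[x y] /=]].
  rewrite (coord_vbasis xU) (coord_vbasis yV) linear_sumlz.
  apply: memv_suml => i _; rewrite linear_sumr; apply: memv_suml => j _.
  rewrite linearZl_LR linearZr_LR; do 2!apply: memvZ.
  by apply: sub_W; apply: allpairs_f; apply: mem_nth; rewrite size_tuple.
by case=> xU yV ->; apply: sub_W; apply: vbasis_mem.
Qed.

Fixpoint lower_central k : {vspace g} :=
  if k is k'.+1 then lie_prodv fullv (lower_central k') else fullv.

Definition lie_nilpotent : Prop := exists k, lower_central k = 0%VS.

Definition ad x : 'End(g) := linfun (lie_bracket x).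

Lemma adE x y : ad x y = [x, y].
Proof. exact: lfunE. Qed.

Definition ad_exp x k : 'End(g) := iter k (comp_lfun (ad x)) \1%VF.

Lemma ad_expE x k y : ad_exp x k y = iter k (lie_bracket x) y.
Proof.
elim: k => [|k IHk]; first by rewrite id_lfunE.
by rewrite /= comp_lfunE -/(ad_exp x k) IHk adE.
Qed.

(* Subtraction on nat is truncated: in dimension 1 the exponent is read as 0,
   so a line counts as filiform. *)
Definition filiform : Prop :=
  lie_nilpotent /\ exists x, ad_exp x (\dim {:g} - 2) != 0.

Definition lie_subalgebra h : Prop := {in h &, forall x y, [x, y] \in h}.

Definition lie_invariant h W : Prop := {in W & h, forall x y, [x, y] \in W}.

End LieAlgebra.

Arguments lower_central {F} g k.
Arguments lie_nilpotent {F} g.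
Arguments filiform {F} g.

(* Main.v *)
Require Import Defs.
From mathcomp Require Import all_boot all_order all_algebra.
From mathcomp Require Import reals.
From mathcomp Require Import zify.

(** For dim g <= 2 the bound says no more than dim h < dim g.  Let
    n = dim g >= 3, let C i be the lower central series, with C 0 = g, and let m
    be the orthogonal complement of h, so that g = h + m (direct) and
    [m, h] <= m.

    For a filiform g, dim (C i) = n - 1 - i for i >= 1 (lcs_dim), so all the
    quotients C i / C i.+1 with 1 <= i <= n - 2 are lines, and what matters
    about an element x is the set of i at which ad x kills the graded piece,
    i.e. sends C i into C i.+2 (ad_drops x i).  If x and y span g modulo C 1,
    then they do not both drop at the same i <= n - 3.  There are two ways to
    bound dim h.
    - If T \in m \ C 1 does not drop at 0 < i < p, and the centralizer of T in h
      lies in C 1, then this centralizer lies in C p, while ad T maps h into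
      m \cap C 1, a proper subspace of m (invariant_dim_bound).
    - If Y \in h does not drop at 0 < i < p and [Y, T] \notin C 2 for some
      T \in m, then the elements ad Y ^ k T with k <= p are p + 1 independent
      elements of m (iter_lie_notin, dim_gt_filtered).

    If h <= C 1, the component along m of an element x with
    ad x ^ (n - 2) != 0 never drops, and the first bound applies with
    p = n - 2.  Otherwise take Y \in h \ C 1; a proper subalgebra does not span
    g modulo C 1 (subalgebra_lcs1), so there is T \in m such that Y and T span g
    modulo C 1.  The key fact (ad_drops_spread) is Vergne's: an element which
    drops at 1 drops at all i with 1 <= i <= n - 4.
    - If Y does not drop at 1, some T - c Y does, hence at every i <= n - 4, so
      Y drops at none of them, and the second bound gives dim h <= 2.
    - If Y drops at 1, then T does not drop at 1 <= i <= n - 4.  The first bound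
      applies with p = n - 2, or with p = n - 3 when T drops at n - 3; it then
      reads 2 dim h <= n + 1, but in that case n is even
      (ad_drops_last_even). *)

Set Implicit Arguments.
Unset Strict Implicit.
Unset Printing Implicit Defensive.

Import Order.TTheory GRing.Theory Num.Theory.
Local Open Scope ring_scope.
Local Open Scope lie_scope.

(** * Brackets *)

Section Bracket.

Variables (F : fieldType) (g : lieAlgType F).
Implicit Types (x y z : g) (a : F).

Lemma lieDl x y z : [x + y, z] = [x, z] + [y, z].
Proof. exact: linearDl. Qed.

Lemma lieDr x y z : [x, y + z] = [x, y] + [x, z].
Proof. exact: linearD. Qed.

Lemma lieZl a x y : [a *: x, y] = a *: [x, y].
Proof. exact: linearZl_LR. Qed.

Lemma lieZr a x y : [x, a *: y] = a *: [x, y].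
Proof. exact: linearZr_LR. Qed.

Lemma lieBl x y z : [x - y, z] = [x, z] - [y, z].
Proof. exact: linearBl. Qed.

Lemma lieBr x y z : [x, y - z] = [x, y] - [x, z].
Proof. exact: linearB. Qed.

Lemma lieC x y : [x, y] = - [y, x].
Proof.
apply/eqP; rewrite -addr_eq0; apply/eqP; have := lie_bracketxx (x + y).
by rewrite lieDl !lieDr !lie_bracketxx add0r addr0.
Qed.

Lemma lie_leibniz x y z : [x, [y, z]] = [[x, y], z] + [y, [x, z]].
Proof.
have := lie_jacobi x y z; rewrite [[z, [x, y]]]lieC [[z, x]]lieC.
rewrite -[- [x, z]]scaleN1r lieZr scaleN1r => /eqP.
by rewrite -addrA addr_eq0 opprD !opprK addrC => /eqP.
Qed.

End Bracket.

(** * The lower central series *)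

Section LowerCentral.

Variables (F : fieldType) (g : lieAlgType F).
Implicit Types (x y z : g) (a : F) (i j : nat).
Local Notation C := (lower_central g).

Lemma lie_lcsS i x y : y \in C i -> [x, y] \in C i.+1.
Proof.
have /lie_prodvP := subvv (C i.+1).
by move=> sub yi; apply: sub; rewrite ?memvf.
Qed.

Lemma lcsS_sub i : (C i.+1 <= C i)%VS.
Proof.
elim: i => [|i IHi]; first exact: subvf.
by apply/lie_prodvP => x y _ /(subvP IHi) yi; apply: lie_lcsS.
Qed.

Lemma lcs_sub i j : (i <= j)%N -> (C j <= C i)%VS.
Proof.
move/subnK <-; elim: (j - i)%N => [|k IHk]; first exact: subvv.
exact: subv_trans (lcsS_sub _) IHk.
Qed.

Lemma mem_lcs_le i j x : (i <= j)%N -> x \in C j -> x \in C i.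
Proof. by move/lcs_sub/subvP; apply. Qed.

(** The Jacobi identity [y, [u, v]] = [[y, u], v] + [u, [y, v]] moves one step
    of the depth of the left argument over to the right one. *)
Lemma lie_lcs i j x y : x \in C i -> y \in C j -> [x, y] \in C (i + j).+1.
Proof.
elim: i j x y => [|i IHi] j x y; first by move=> _; apply: lie_lcsS.
move=> xi yj; rewrite lieC rpredN -adE memv_preim.
move: x xi; apply/subvP; apply/lie_prodvP => u v _ vi; rewrite -memv_preim adE.
rewrite lie_leibniz rpredD //; last first.
  by apply: lie_lcsS; rewrite lieC rpredN IHi.
by rewrite lieC rpredN addSnnS; apply: IHi => //; rewrite lieC rpredN lie_lcsS.
Qed.

Hypothesis nil_g : lie_nilpotent g.

(** The lower central series of a nilpotent algebra cannot stall above zero,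
    since each term determines the next one. *)
Lemma lcs_stable0 i : C i = C i.+1 -> C i = 0%VS.
Proof.
move=> eqC; have stable k : C (i + k) = C i.
  by elim: k => [|k IHk]; rewrite ?addn0 // addnS /= IHk -/(C i.+1).
have [k Ck0] := nil_g; apply/eqP; rewrite -subv0 -Ck0 -(stable k).
by apply: lcs_sub; rewrite leq_addl.
Qed.

Lemma lcs_lt_dim i : C i != 0%VS -> (\dim (C i.+1) < \dim (C i))%N.
Proof.
apply: contraR; rewrite -leqNgt => le_dim; apply/eqP/lcs_stable0/esym/eqP.
by rewrite eqEdim lcsS_sub.
Qed.

Lemma mem_lcs_span i u x : u \notin C i.+1 ->
    (\dim (C i) <= (\dim (C i.+1)).+1)%N -> u \in C i -> x \in C i ->
  exists a, x - a *: u \in C i.+1.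
Proof.
move=> u'i1 le_dim ui xi.
have sub : (<[u]> + C i.+1 <= C i)%VS by rewrite subv_add -memvE ui lcsS_sub.
have: x \in (<[u]> + C i.+1)%VS.
  suff /eqP-> : (<[u]> + C i.+1 == C i)%VS by [].
  rewrite eqEdim sub (leq_trans le_dim) // ltnNge; apply: contra u'i1 => le'.
  have /eqP-> : C i.+1 == (<[u]> + C i.+1)%VS by rewrite eqEdim addvSr.
  by rewrite memvE addvSl.
case/memv_addP=> _ /vlineP[a ->] [w wi1 ->]; exists a.
by rewrite addrC addKr.
Qed.

(** If g were spanned by one element u modulo [g, g], then [u, u] = 0 would give
    C 1 = C 2, hence C 1 = 0 and g would be a line. *)
Lemma lcs1_codim : (1 < \dim {:g})%N -> (\dim (C 1) + 2 <= \dim {:g})%N.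
Proof.
move=> g_gt1; have g_neq0: C 0 != 0%VS by rewrite -dimv_eq0 -lt0n ltnW.
have lt10 := lcs_lt_dim g_neq0; rewrite addn2 ltn_neqAle lt10 andbT.
apply/eqP => dim1.
have /subvPn[u u0 u1] : ~~ (C 0 <= C 1)%VS.
  by apply: contraL lt10 => /dimvS; rewrite leqNgt.
have span1 x : exists a, x - a *: u \in C 1.
  by apply: mem_lcs_span => //; rewrite ?memvf // dim1.
have C12 : C 1 = C 2.
  apply/eqP; rewrite eqEsubv lcsS_sub andbT; apply/lie_prodvP => x y _ _.
  have [[a xa] [b yb]] := (span1 x, span1 y).
  rewrite -[x](subrK (a *: u)) lieDl rpredD //.
    by rewrite lieC rpredN lie_lcsS.
  rewrite -[y](subrK (b *: u)) lieDr rpredD //; first by rewrite lie_lcsS.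
  by rewrite lieZl lieZr lie_bracketxx !scaler0 rpred0.
by move: dim1; rewrite (lcs_stable0 C12) dimv0 => eq1; rewrite -eq1 in g_gt1.
Qed.

End LowerCentral.

(** * Iterated brackets *)

Section IteratedBracket.

Variables (F : fieldType) (g : lieAlgType F) (x t : g).
Local Notation C := (lower_central g).
Local Notation e k := (iter k (lie_bracket x) t).

Lemma iter_lie_lcs k : e k \in C k.
Proof. by elim: k => [|k IHk]; rewrite ?memvf //= lie_lcsS. Qed.

Lemma lie_iter_shift a b : [e a.+1, e b] = [x, [e a, e b]] - [e a, e b.+1].
Proof. by rewrite [[x, [_, _]]]lie_leibniz /= addrK. Qed.

(** The recursion of lie_iter_shift, read modulo W: along the antidiagonal
    a + b = p the brackets of the iterates only change sign. *)
Lemma lie_iter_sign (W : {vspace g}) p a :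
    (forall b c, (b + c).+1 = p -> [x, [e b, e c]] \in W) -> (a <= p)%N ->
  [e a, e (p - a)] - (-1) ^+ a *: [t, e p] \in W.
Proof.
move=> W_lie; elim: a => [_|a IHa lt_ap].
  by rewrite subn0 expr0 scale1r subrr mem0v.
have := IHa (ltnW lt_ap); rewrite -[(p - a)%N](subnSK lt_ap) => Wa.
rewrite lie_iter_shift exprS mulN1r scaleNr opprK.
suff /rpredB/(_ Wa) : [x, [e a, e (p - a.+1)]] \in W.
  by rewrite opprB addrA addrAC.
by apply: W_lie; lia.
Qed.

End IteratedBracket.

(** * The action on the graded pieces of the lower central series *)

Section Drops.

Variables (F : fieldType) (g : lieAlgType F).
Implicit Types (x y A B : g) (a : F) (i j k : nat).
Local Notation C := (lower_central g).

(** The map C i / C i.+1 -> C i.+1 / C i.+2 induced by ad x is zero. *)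
Definition ad_drops x i : bool := (ad x @: C i <= C i.+2)%VS.

Lemma ad_dropsP x i :
  reflect (forall u, u \in C i -> [x, u] \in C i.+2) (ad_drops x i).
Proof.
apply: (iffP subvP) => [sub u ui | drops y].
  by rewrite -adE sub ?memv_img.
by case/memv_imgP=> u ui ->; rewrite adE drops.
Qed.

(** For nilpotent g this means that A and B generate g as a Lie algebra. *)
Definition spans_lcs1 A B : bool := (fullv <= <[A]> + <[B]> + C 1)%VS.

Lemma spans_lcs1P A B x : spans_lcs1 A B ->
  exists a b, exists2 c, c \in C 1 & x = a *: A + b *: B + c.
Proof.
move/subvP/(_ x (memvf _)); case/memv_addP=> y /memv_addP[_ /vlineP[a ->]].
by case=> _ /vlineP[b ->] -> [c c1 ->]; exists a, b, c.
Qed.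

Lemma spans_lcs1C A B : spans_lcs1 A B = spans_lcs1 B A.
Proof. by rewrite /spans_lcs1 [(<[A]> + _)%VS]addvC. Qed.

Lemma spans_lcs1_shear A B a : spans_lcs1 A B -> spans_lcs1 A (B - a *: A).
Proof.
move/subv_trans; apply; rewrite addvS // subv_add addvSl -memvE.
have := memv_add (memvZ a (memv_line A)) (memv_line (B - a *: A)).
by rewrite addrC subrK.
Qed.

Lemma ad_drops_lcs1 x i : x \in C 1 -> ad_drops x i.
Proof. by move=> x1; apply/ad_dropsP => u ui; apply: (lie_lcs x1 ui). Qed.

(** C i.+1 is spanned modulo C i.+2 by the brackets of A and B with C i. *)
Lemma lcs_pair_drops A B i : spans_lcs1 A B ->
  ad_drops A i -> ad_drops B i -> (C i.+1 <= C i.+2)%VS.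
Proof.
move=> spanAB /ad_dropsP dA /ad_dropsP dB; apply/lie_prodvP => x u _ ui.
have [a [b [c c1 ->]]] := spans_lcs1P x spanAB.
rewrite !lieDl !lieZl !rpredD ?rpredZ ?dA ?dB //.
exact: (ad_dropsP _ _ (ad_drops_lcs1 i c1)).
Qed.

End Drops.

(** * Filiform Lie algebras *)

Section Filiform.

Variables (F : fieldType) (g : lieAlgType F).
Hypotheses (fil_g : filiform g) (g_gt2 : (2 < \dim {:g})%N).
Implicit Types (x y A B T Y : g) (i j k p : nat).
Local Notation C := (lower_central g).
Local Notation n := (\dim {:g}).

Lemma lcs_dim_le i : (0 < i)%N -> (\dim (C i) <= n - i.+1)%N.
Proof.
case: fil_g => nil_g _.
elim: i => [|[_ _|i IHi _]] //; first by have := lcs1_codim nil_g; lia.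
have [C0|/(lcs_lt_dim nil_g)] := eqVneq (C i.+1) 0%VS; last first.
  by have := IHi isT; lia.
by have := lcsS_sub g i.+1; rewrite C0 subv0 => /eqP->; rewrite dimv0.
Qed.

(** A nonzero ad x ^ (n - 2) forces C (n - 2) != 0, and the series is strictly
    decreasing down to that term. *)
Lemma lcs_dim_ge i : (0 < i)%N -> (n - i.+1 <= \dim (C i))%N.
Proof.
case: fil_g => nil_g [x xn].
have top0 : C (n - 2) != 0%VS.
  apply: contraNneq xn => top0; apply/eqP/lfunP => y; rewrite ad_expE lfunE /=.
  by apply/eqP; rewrite -memv0 -top0; apply: iter_lie_lcs.
have neq0 i' : (i' <= n - 2)%N -> C i' != 0%VS.
  by move/lcs_sub => sub; apply: contraNneq top0 => C0; rewrite -subv0 -C0.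
have aux k : (k <= n - 2)%N -> (k < \dim (C (n - 2 - k)))%N.
  elim: k => [_|k IHk lt_k]; first by rewrite subn0 lt0n dimv_eq0.
  apply: leq_ltn_trans (IHk (ltnW lt_k)) _; rewrite -(subnSK lt_k).
  by apply: lcs_lt_dim => //; apply: neq0; lia.
move=> i0; case: (leqP n i.+1) => le_in; first by lia.
have := aux (n - 2 - i)%N (leq_subr _ _).
have -> : (n - 2 - (n - 2 - i) = i)%N by lia.
by lia.
Qed.

Lemma lcs_dim i : (0 < i)%N -> \dim (C i) = (n - i.+1)%N.
Proof. by move=> i0; apply/eqP; rewrite eqn_leq lcs_dim_le ?lcs_dim_ge. Qed.

Lemma lcs_last i : (n <= i.+1)%N -> C i = 0%VS.
Proof. by move=> le_ni; apply/eqP; rewrite -dimv_eq0 lcs_dim; lia. Qed.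

Lemma lcsS_not_sub i : (i.+1 < n)%N -> ~~ (C i <= C i.+1)%VS.
Proof.
move=> lt_in; apply/negP => /dimvS; rewrite (@lcs_dim i.+1) //.
by case: i lt_in => [|i] lt_in; [rewrite /= | rewrite lcs_dim //]; lia.
Qed.

Lemma lcs_span i u x : (0 < i)%N -> u \in C i -> u \notin C i.+1 ->
  x \in C i -> exists a, x - a *: u \in C i.+1.
Proof.
by move=> i0 ui u'i xi; apply: mem_lcs_span => //; rewrite !lcs_dim; lia.
Qed.

(** As C i / C i.+1 is a line, one nonzero vector of it decides. *)
Lemma ad_drops_witness x u i : (0 < i)%N -> u \in C i -> u \notin C i.+1 ->
  ad_drops x i = ([x, u] \in C i.+2).
Proof.
move=> i0 ui u'i; apply/ad_dropsP/idP => [|xu y yi]; first exact.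
have [a ya] := lcs_span i0 ui u'i yi.
by rewrite -[y](subrK (a *: u)) lieDr lieZr rpredD ?rpredZ // lie_lcsS.
Qed.

Lemma ad_drops_pair A B i : (i.+2 < n)%N -> spans_lcs1 A B ->
  ad_drops A i -> ~~ ad_drops B i.
Proof.
move=> lt_in spanAB dA; apply: contra (lcsS_not_sub lt_in).
exact: lcs_pair_drops dA.
Qed.

Lemma spans_lie_notin A B : spans_lcs1 A B -> [A, B] \notin C 2.
Proof.
move=> spanAB; apply: contra (lcsS_not_sub g_gt2) => AB2.
apply/lie_prodvP => x y _ _.
have [a [b [c c1 ->]]] := spans_lcs1P x spanAB.
have [a' [b' [c' c1' ->]]] := spans_lcs1P y spanAB.
rewrite lieDr rpredD //; last by rewrite lie_lcsS.
rewrite lieDl rpredD //; last by rewrite lieC rpredN lie_lcsS.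
rewrite !lieDl !lieDr !lieZl !lieZr !lie_bracketxx !scaler0 add0r addr0.
by rewrite rpredD ?rpredZ // lieC rpredN.
Qed.

(** Both induced maps go between the same two lines, and that of A is nonzero,
    hence that of B is a multiple of it. *)
Lemma ad_drops_combination A B i : (0 < i)%N -> ~~ ad_drops A i ->
  exists a, ad_drops (B - a *: A) i.
Proof.
move=> i0; rewrite /ad_drops => /subvPn[_ /memv_imgP[u ui ->]]; rewrite adE.
move=> Au; have u'i : u \notin C i.+1.
  by apply: contra Au; apply: lie_lcsS.
have [//|||a Ba] := @lcs_span i.+1 [A, u] [B, u] _ _ Au; try exact: lie_lcsS.
exists a; rewrite -/(ad_drops _ i) (ad_drops_witness _ i0 ui u'i).
by rewrite lieBl lieZl.
Qed.

(** Each application of ad x goes down exactly one step of the series as long as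
    x does not drop. *)
Lemma iter_lie_notin x t p : [x, t] \notin C 2 ->
    (forall i, (0 < i < p)%N -> ~~ ad_drops x i) ->
  forall k, (k <= p)%N -> iter k (lie_bracket x) t \notin C k.+1.
Proof.
move=> xt ndx; elim=> [_|[_ _|k IHk lt_kp]] //.
  by apply: contra xt; apply: lie_lcsS.
have := ndx k.+1; rewrite ltnS leq0n lt_kp => /(_ isT); apply: contra.
rewrite (ad_drops_witness _ _ _ (IHk (ltnW lt_kp))) //.
exact: (iter_lie_lcs x t k.+1).
Qed.

(** Let j > 1 be the first place where A does not drop, replace B by the
    combination D = B - c A which drops at j, and put e k = ad D ^ k A.  The
    brackets [e a, e b] with a + b = j agree up to sign with f = [A, e j], which
    spans C j.+1 modulo C j.+2; comparing those with a + b = j + 1 at both ends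
    of the antidiagonal gives (j + 1) [D, f] = 0 modulo C j.+3, and the Jacobi
    identity gives [A, f] = 0 modulo C j.+3.  Thus A and D both drop at j + 1,
    which cannot happen when j + 1 <= n - 3. *)
Lemma ad_drops_spread A B i : [pchar F] =i pred0 -> spans_lcs1 A B ->
  ad_drops A 1 -> (0 < i)%N -> (i.+3 < n)%N -> ad_drops A i.
Proof.
move=> char0 span0 dA1; have /ad_dropsP dA1P := dA1.
elim/ltn_ind: i => j IHj j0 lt_jn.
have [-> // | j1] := eqVneq j 1%N; have {j1 j0} j_gt1 : (1 < j)%N by lia.
apply/negPn/negP => ndA.
have [c] := ad_drops_combination B (ltnW j_gt1) ndA.
have {span0} := spans_lcs1_shear c span0; move: (B - _) => D span dD.
have dA i : (0 < i < j)%N -> ad_drops A i by move=> i_j; apply: IHj; lia.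
pose e k := iter k (lie_bracket D) A.
have eC k : e k \in C k by apply: iter_lie_lcs.
have ej : e j \notin C j.+1.
  apply: (@iter_lie_notin D A j) => // [|i i_j].
    by rewrite spans_lie_notin // spans_lcs1C.
  by apply: ad_drops_pair span _; [lia | apply: dA].
pose f := [A, e j].
have f'j : f \notin C j.+2 by rewrite -(ad_drops_witness _ _ (eC j)) // ltnW.
have fC : f \in C j.+1 by apply: lie_lcsS.
have low a b : (a + b < j)%N -> [e a, e b] \in C (a + b).+2.
  elim: a b => [|a IHa] b ab.
    case: b ab => [|b] ab; first by rewrite lie_bracketxx mem0v.
    by apply: (ad_dropsP _ _ (dA b.+1 _)); rewrite // add0n in ab *.
  rewrite lie_iter_shift -/(e a) -/(e b) -/(e b.+1) rpredB //.
    by rewrite addSn lie_lcsS // IHa //; lia.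
  by rewrite addSnnS IHa // -addSnnS.
have sign a : (a <= j)%N -> [e a, e (j - a)%N] - (-1) ^+ a *: f \in C j.+2.
  move=> le_aj; apply: lie_iter_sign => // b d eq_j.
  by rewrite -eq_j lie_lcsS // low // -eq_j.
have Df : [D, f] \in C j.+3.
  (* Modulo C j.+3, up to alternating signs, the brackets [e a, e b] with
     a + b = j + 1 form an arithmetic progression of step [D, f]; it starts at
     [e 0, e j.+1] = 0, because D drops at j. *)
  have arith a : (a <= j.+1)%N ->
      [e a, e (j.+1 - a)%N] + ((-1) ^+ a * a%:R) *: [D, f] \in C j.+3.
    elim: a => [_|a IHa lt_aj].
      rewrite mulr0 scale0r addr0 subn0 lie_lcsS //.
      exact: (ad_dropsP _ _ dD).
    have := IHa (ltnW lt_aj); rewrite subSn // => sum_a.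
    have := lie_lcsS D (sign a lt_aj); rewrite lieBr lieZr => sgn_a.
    rewrite subSS lie_iter_shift -/(e a) -/(e (j - a)%N) -/(e (j - a)%N.+1).
    have -> : ((-1) ^+ a.+1 * a.+1%:R) *: [D, f] =
        - ((-1) ^+ a *: [D, f]) - ((-1) ^+ a * a%:R) *: [D, f].
      rewrite exprS mulN1r mulNr scaleNr -natr1 mulrDr mulr1.
      by rewrite scalerDl opprD addrC.
    by have := rpredB sgn_a sum_a; rewrite opprD !addrA [X in X - _]addrAC.
  (* The other end [e j.+1, e 0] vanishes for the same reason. *)
  have := arith j.+1 (leqnn _); rewrite subnn rpredDl.
    by rewrite rpredZeq mulf_eq0 signr_eq0 ((pcharf0P _).1 char0) /=.
  rewrite lieC rpredN lie_lcsS //.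
  exact: (ad_dropsP _ _ dD).
have Af : [A, f] \in C j.+3.
  (* f = - [e 1, e (j - 1)] modulo C j.+2, and A drops at 1 and at j - 1. *)
  have := lie_lcsS A (sign 1%N (ltnW j_gt1)).
  rewrite expr1 scaleN1r opprK lieDr rpredDl // lie_leibniz rpredD //.
    have -> : j.+3 = (3 + (j - 1)).+1 by lia.
    by apply: lie_lcs => //; apply: dA1P.
  have -> : j.+3 = (1 + j.+1).+1 by lia.
  apply: lie_lcs => //; have -> : j.+1 = (j - 1)%N.+2 by lia.
  by apply: (ad_dropsP _ _ (dA _ _)) => //; lia.
have := @ad_drops_pair A D j.+1 lt_jn span.
by rewrite !(ad_drops_witness _ _ fC) // Af Df => /(_ isT).
Qed.

(** A subalgebra which spans g modulo C 1 spans each C i modulo C i.+1, hence is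
    the whole of the nilpotent algebra g. *)
Lemma subalgebra_lcs1 (h : {vspace g}) :
  lie_subalgebra h -> (fullv <= h + C 1)%VS -> h = fullv.
Proof.
move=> sub_h h1; have hC i : (C i <= h + C i.+1)%VS.
  elim: i => [|i IHi]; first exact: h1.
  apply/lie_prodvP => x y _ yi.
  have [x1 x1h [x2 x2C ->]] := memv_addP (subvP h1 x (memvf x)).
  have [y1 y1h [y2 y2C def_y]] := memv_addP (subvP IHi y yi).
  have y1C : y1 \in C i.
    by rewrite -(rpredDr _ (mem_lcs_le (leqnSn i) y2C)) -def_y.
  rewrite def_y lieDl [[x1, _]]lieDr -addrA memv_add ?sub_h // rpredD //.
    exact: lie_lcsS.
  by rewrite -def_y; apply: (lie_lcs x2C yi).
have {}hC i : (fullv <= h + C i)%VS.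
  elim: i => [|i IHi]; first by rewrite addvSr.
  by rewrite (subv_trans IHi) // subv_add addvSl hC.
have [[k Ck0] _] := fil_g; apply/eqP; rewrite eqEsubv subvf /=.
by have := hC k; rewrite Ck0 addv0.
Qed.

(** Vectors of pairwise different depths are independent: V :&: C i shrinks
    strictly at each of the p + 1 steps. *)
Lemma dim_gt_filtered (V : {vspace g}) (e : nat -> g) p :
    (forall k, (k <= p)%N -> [/\ e k \in V, e k \in C k & e k \notin C k.+1]) ->
  (p < \dim V)%N.
Proof.
move=> eP; suff aux k : (k <= p.+1)%N -> (k <= \dim (V :&: C (p.+1 - k)%N))%N.
  by apply: leq_trans (aux p.+1 (leqnn _)) _; rewrite dimvS ?capvSl.
elim: k => [//|k IHk] lt_kp; apply: leq_ltn_trans (IHk (ltnW lt_kp)) _.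
have [|eV eC e'C] := eP (p.+1 - k.+1)%N; first by lia.
rewrite -(subnSK lt_kp) ltnNge; apply: contra e'C => le_dim.
set W := (V :&: C (p.+1 - k.+1)%N)%VS in le_dim.
suff /eqP WE : (V :&: C (p.+1 - k.+1)%N.+1)%VS == W.
  have: e (p.+1 - k.+1)%N \in W by rewrite memv_cap eV.
  by rewrite -WE memv_cap => /andP[].
by rewrite eqEdim le_dim capvS // lcsS_sub.
Qed.

(** The element x of the definition of filiform works: a single drop would push
    ad x ^ (n - 2) into C (n - 1) = 0. *)
Lemma filiform_witness : exists x, forall i, (i.+2 < n)%N -> ~~ ad_drops x i.
Proof.
case: fil_g => _ [x /eqP xn]; exists x => i lt_in; apply/negP => /ad_dropsP dx.
apply: xn; apply/lfunP => y; rewrite ad_expE lfunE /=.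
suff: iter (n - 2) (lie_bracket x) y \in C (n - 1).
  by rewrite lcs_last ?memv0; [move/eqP | lia].
have aux k : iter (k + i.+1) (lie_bracket x) y \in C (k + i.+2).
  elim: k => [|k IHk]; last by rewrite !addSn /= lie_lcsS.
  by rewrite !add0n /= dx // iter_lie_lcs.
have := aux (n - 2 - i.+1)%N.
by rewrite subnK; [congr (_ \in C _) | ]; lia.
Qed.

(** An element of exact depth 0 < i < p cannot commute with T, which does not
    drop at i. *)
Lemma cent_lcs T u p : (forall i, (0 < i < p)%N -> ~~ ad_drops T i) ->
  (0 < p)%N -> u \in C 1 -> [T, u] = 0 -> u \in C p.
Proof.
move=> ndT; case: p ndT => [//|p] ndT _ u1 Tu.
elim: p ndT => [//|p IHp] ndT.
have up : u \in C p.+1 by apply: IHp => i i_p; apply: ndT; lia.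
have := ndT p.+1; rewrite !ltnS leqnn => /(_ isT); apply: contraNT => u'p.
by rewrite (ad_drops_witness _ _ up) // Tu mem0v.
Qed.

(** Rank-nullity for ad T : h -> m.  The image lies in C 1, so it misses T; the
    kernel lies in C p, of dimension n - p - 1. *)
Lemma invariant_dim_bound (h m : {vspace g}) T p : lie_invariant h m ->
    T \in m -> T \notin C 1 -> (0 < p)%N ->
    (forall u, u \in h -> [T, u] = 0 -> u \in C p) ->
  (\dim h < \dim m + (n - p.+1))%N.
Proof.
move=> inv_m Tm T'1 p0 centT.
have ker_le : (\dim (h :&: lker (ad T)) <= n - p.+1)%N.
  rewrite -lcs_dim // dimvS //; apply/subvP => u; rewrite memv_cap memv_ker adE.
  by case/andP=> uh /eqP; apply: centT.
have img_lt : (\dim (ad T @: h) < \dim m)%N.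
  have sub : (ad T @: h <= m)%VS.
    by apply/subvP => _ /memv_imgP[u uh ->]; rewrite adE inv_m.
  rewrite ltn_neqAle dimvS // andbT; apply: contra T'1 => eq_dim.
  have /eqP eq_m : (ad T @: h)%VS == m by rewrite eqEdim sub (eqP eq_dim) leqnn.
  by move: Tm; rewrite -eq_m => /memv_imgP[u _ ->]; rewrite adE lie_lcsS ?memvf.
by have := limg_ker_dim (ad T) h; lia.
Qed.

(** With e k = ad T ^ k Y, the brackets [e a, e b] with a + b = n - 3 agree up
    to sign, since T drops at n - 3.  For n odd the middle one is
    [e i, e i] = 0, so [Y, e (n - 3)] = 0 and Y would drop at n - 3 as well. *)
Lemma ad_drops_last_even Y T : spans_lcs1 Y T ->
    (forall i, (0 < i)%N -> (i.+3 < n)%N -> ~~ ad_drops T i) ->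
  ad_drops T (n - 3) -> ~~ odd n.
Proof.
move=> span ndT dT; apply/negP => odd_n.
pose e k := iter k (lie_bracket T) Y.
have eC k : e k \in C k by apply: iter_lie_lcs.
have e'C : e (n - 3)%N \notin C (n - 3)%N.+1.
  apply: (@iter_lie_notin T Y (n - 3)) => //.
    by rewrite spans_lie_notin // spans_lcs1C.
  by move=> i i_n; apply: ndT; lia.
have [i [def_n]] : exists i, (n = i.*2 + 3)%N.
  by exists n./2.-1; lia.
have := @lie_iter_sign _ _ T Y 0%VS (n - 3) i.
have -> : (n - 3 - i = i)%N by lia.
rewrite lie_bracketxx sub0r rpredN rpredZeq signr_eq0 /= memv0 => Y0.
have {}Y0 : [Y, e (n - 3)%N] = 0.
  apply/eqP/Y0; last by lia.
  move=> b c bc; rewrite -(@lcs_last (n - 1)); last by lia.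
  have -> : (n - 1 = (n - 3).+2)%N by lia.
  by apply: (ad_dropsP _ _ dT); rewrite -bc; apply: lie_lcs; apply: eC.
have [i0|i0] := posnP i.
  (* For n = 3 that argument is void, but T cannot drop at 0. *)
  have n3 : (n - 3 = 0)%N by lia.
  have := spans_lie_notin span; rewrite lieC rpredN n3 in dT * => /negP; apply.
  by apply: (ad_dropsP _ _ dT); apply: memvf.
have : ~~ ad_drops Y (n - 3).
  by apply: (ad_drops_pair _ _ dT); [lia | rewrite spans_lcs1C].
by rewrite (ad_drops_witness _ _ (eC _)) ?Y0 ?mem0v //; lia.
Qed.

Lemma spans_lcs1_indep A B :
  A \notin C 1 -> B \notin (<[A]> + C 1)%VS -> spans_lcs1 A B.
Proof.
move=> A'1 B'; rewrite /spans_lcs1 [(<[A]> + _)%VS]addvC -addvA.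
suff /eqP-> : (<[B]> + (<[A]> + C 1))%VS == fullv by apply: subvv.
rewrite eqEdim subvf.
have lt_line (W : {vspace g}) x : x \notin W -> (\dim W < \dim (<[x]> + W))%N.
  move=> x'W; rewrite ltnNge; apply: contra x'W => le_dim.
  have /eqP-> : W == (<[x]> + W)%VS by rewrite eqEdim addvSr.
  by rewrite memvE addvSl.
have dim1 := lcs_dim (isT : (0 < 1)%N).
by have := lt_line _ _ A'1; have := lt_line _ _ B'; lia.
Qed.

(** The theorem for an arbitrary h-invariant linear complement of h. *)
Lemma reductive_subalgebra_dim (h m : {vspace g}) : [pchar F] =i pred0 ->
    lie_subalgebra h -> h != fullv -> lie_invariant h m ->
    (h + m)%VS = fullv -> (h :&: m)%VS = 0%VS ->
  (\dim h * 2 <= n)%N.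
Proof.
move=> char0 sub_h h_proper inv_m hm cap_hm.
have dim_hm : (\dim h + \dim m = n)%N by rewrite -hm dimv_disjoint_sum.
have [h1 | /subvPn[Y Yh Y'1]] := boolP (h <= C 1)%VS.
  have [x ndx] := filiform_witness.
  have: x \in (h + m)%VS by rewrite hm memvf.
  case/memv_addP=> y yh [T Tm def_x].
  have ndT i : (i.+2 < n)%N -> ~~ ad_drops T i.
    move=> lt_in; apply: contra (ndx i lt_in) => /ad_dropsP dT.
    have /ad_dropsP dy := ad_drops_lcs1 i (subvP h1 y yh).
    by apply/ad_dropsP => u ui; rewrite def_x lieDl rpredD ?dy ?dT.
  have T'1 : T \notin C 1 by apply: contra (ndT 0 g_gt2); apply: ad_drops_lcs1.
  suff : (\dim h < \dim m + (n - (n - 2).+1))%N by lia.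
  apply: invariant_dim_bound inv_m Tm T'1 _ _; first by lia.
  move=> u uh; apply: cent_lcs => [i i_p||]; [|by lia|exact: (subvP h1)].
  by apply: ndT; lia.
have [T Tm T'h] : exists2 T, T \in m & T \notin (h + C 1)%VS.
  apply/subvPn; apply: contra h_proper => m1; apply/eqP/subalgebra_lcs1 => //.
  by rewrite -hm subv_add addvSl.
have span : spans_lcs1 Y T.
  apply: spans_lcs1_indep => //; apply: contra T'h; apply: subvP.
  by rewrite addvS // -memvE.
have T'1 : T \notin C 1 by apply: contra T'h; apply/subvP; apply: addvSr.
have cent1 u : u \in h -> [T, u] = 0 -> u \in C 1.
  move=> uh Tu; have [a [b [c c1 def_u]]] := spans_lcs1P u span.
  have b0 : b = 0.
    apply: contraNeq T'h => b_neq0.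
    have bT : b *: T = u - a *: Y - c by rewrite def_u addrAC addrK addrC addKr.
    have : b *: T \in (h + C 1)%VS.
      by rewrite bT memv_add // ?rpredB ?rpredN // rpredZ.
    by rewrite rpredZeq (negbTE b_neq0).
  have a0 : a = 0.
    apply: contraNeq (spans_lie_notin span) => a_neq0.
    move: Tu; rewrite def_u b0 scale0r addr0 lieDr lieZr => /eqP.
    rewrite addr_eq0 => /eqP aTY.
    have : a *: [T, Y] \in C 2 by rewrite aTY rpredN lie_lcsS.
    by rewrite rpredZeq (negbTE a_neq0) /= lieC rpredN.
  by rewrite def_u a0 b0 !scale0r !add0r.
have bound p : (0 < p)%N -> (forall i, (0 < i < p)%N -> ~~ ad_drops T i) ->
    (\dim h < \dim m + (n - p.+1))%N.
  move=> p_gt0 ndT; apply: (invariant_dim_bound inv_m Tm T'1 p_gt0) => u uh Tu.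
  exact: cent_lcs ndT p_gt0 (cent1 u uh Tu) Tu.
have [dY1 | ndY1] := boolP (ad_drops Y 1).
  have ndT i : (0 < i)%N -> (i.+3 < n)%N -> ~~ ad_drops T i.
    move=> i0 lt_in; apply: (ad_drops_pair _ span); first exact: ltnW.
    exact: ad_drops_spread char0 span dY1 i0 lt_in.
  have [dT | ndTlast] := boolP (ad_drops T (n - 3)).
    have even_n := ad_drops_last_even span ndT dT.
    suff : (\dim h < \dim m + (n - (n - 3).+1))%N by lia.
    by apply: bound; [lia | move=> i i_n; apply: ndT; lia].
  suff : (\dim h < \dim m + (n - (n - 2).+1))%N by lia.
  apply: bound => [|i i_n]; first by lia.
  have [->// | i_neq] := eqVneq i (n - 3)%N.
  by apply: ndT; lia.
have [c dD1] := ad_drops_combination T (ltn0Sn 0) ndY1.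
have := spans_lcs1_shear c span; rewrite spans_lcs1C => spanD.
have ndY i : (0 < i)%N -> (i.+3 < n)%N -> ~~ ad_drops Y i.
  move=> i0 lt_in; apply: (ad_drops_pair _ spanD); first exact: ltnW.
  exact: ad_drops_spread char0 spanD dD1 i0 lt_in.
have n_gt3 : (3 < n)%N.
  rewrite ltnNge; apply: contra ndY1 => n_le3; apply/ad_dropsP => u u1.
  have := lie_lcsS Y u1; rewrite lcs_last // memv0 => /eqP->.
  exact: mem0v.
suff : (n - 3 < \dim m)%N by lia.
apply: (@dim_gt_filtered m (fun k => iter k (lie_bracket Y) T)) => k le_k.
split; last 1 first.
- apply: iter_lie_notin le_k; first exact: spans_lie_notin.
  by move=> i i_p; apply: ndY; lia.
- by elim: k {le_k} => [|k IHk] //=; rewrite lieC rpredN inv_m.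
exact: iter_lie_lcs.
Qed.

End Filiform.

(** * Orthogonal complements *)

Lemma dim_orthov (R : realFieldType) (V : vectType R) (ip : {dot V for idfun})
  (U : {vspace V}) : (\dim {:V} <= \dim (orthov ip U) + \dim U)%N.
Proof.
suff le_size (s : seq V) : (\dim {:V} <= \dim (orthov ip <<s>>) + size s)%N.
  by have := le_size (vbasis U); rewrite (span_basis (vbasisP U)) size_tuple.
elim: s => [|u s IHs] /=.
  by rewrite span_nil orthov0 addn0.
rewrite span_cons.
apply: leq_trans IHs _; rewrite addnS -addSn leq_add2r.
apply: leq_trans (leqSpred _) _; rewrite ltnS.
apply: leq_trans (leq_dim_orthov1 ip u (orthov ip <<s>>)) _.
by rewrite dimvS // orthovD capvSr capvSl.
Qed.

Lemma cap_orthov (R : realFieldType) (V : vectType R) (ip : {dot V for idfun})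
  (U : {vspace V}) : (U :&: orthov ip U = 0)%VS.
Proof.
apply/eqP; rewrite -subv0; apply/subvP => u; rewrite memv_cap => /andP[uU].
move=> /mem_orthovP/(_ u uU); rewrite memv0; apply: contra_eqT => u_neq0.
by rewrite gt_eqF // neq0_dnorm_gt0.
Qed.

Local Close Scope lie_scope.

Theorem theorem1p16 (R : realType) (g : lieAlgType R)
    (ip : {dot g for idfun}) (h : {vspace g}) :
  filiform g ->
  lie_subalgebra h ->
  h != fullv ->
  lie_invariant h (orthov ip h) ->
  (\dim h)%:R <= (\dim {: g})%:R / 2 :> R.
Proof.
move=> fil_g sub_h h_proper inv_h.
rewrite ler_pdivlMr // -natrM ler_nat.
have lt_hg : (\dim h < \dim {:g})%N.
  by rewrite ltnNge; apply: contra h_proper => le_gh; rewrite eqEdim subvf.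
have [g_le2 | g_gt2] := leqP (\dim {:g}) 2; first by lia.
apply: (@reductive_subalgebra_dim _ _ fil_g g_gt2 h (orthov ip h)) => //.
- exact: pchar_num.
- apply/eqP; rewrite eqEdim subvf dimv_disjoint_sum ?cap_orthov //.
  by rewrite addnC dim_orthov.
exact: cap_orthov.
Qed.
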